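(* Let $V$ be the Euclidean space of real symmetric matrices of order $n$ with scalar product $\langle x,y\rangle=\mathrm{trace}(xy)$, let $V_+\subset V$ be the cone of positive definite matrices and $\overline{V_+}$ the cone of positive semidefinite matrices. Let $p\in\{\frac12,1,\frac32,\ldots,\frac{n-1}{2}\}\cup(\frac{n-1}{2},\infty)$ and let $\mu_p$ be the (unbounded) positive measure on $\overline{V_+}$ generating the family of Wishart distributions with shape parameter $p$, defined by $$\int_{\overline{V_+}}e^{-\langle s,x\rangle}\mu_p(dx)=\frac{1}{(\det s)^p},\qquad s\in V_+.$$ Then $\mu_p$ is a dual measure of itself.
   Context: For a positive measure $\mu$ on a finite-dimensional Euclidean space $V$ let $B_\mu(s)=\int_V e^{-\langle s,x\rangle}\mu(dx)$, let $S(\mu)$ be the interior of $\{s: B_\mu(s)<\infty\}$, and $\ell_\mu=\log B_\mu$, with gradient $\ell'_\mu$ with respect to the scalar product. $\mathcal{M}(V)$ is the set of positive measures on $V$ not concentrated on an affine hyperplane and with $S(\mu)\neq\emptyset$. Put $M_{F(\mu)}=-\ell'_\mu(S(\mu))$. A measure $\mu^*\in\mathcal{M}(V)$ is a dual measure of $\mu\in\mathcal{M}(V)$ if $M_{F(\mu)}\subset S(\mu^* )$ and $-\ell'_{\mu^*}(-\ell'_\mu(s))=s$ for all $s\in S(\mu)$. For $p$ in the set above the existence of $\mu_p$ is a known fact. *)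

(* Defs.v *)
From HB Require Import structures.
From mathcomp Require Import all_boot all_order all_algebra.
From mathcomp Require Import all_classical all_reals all_analysis.
From mathcomp Require Import ring.

Set Implicit Arguments.
Unset Strict Implicit.
Unset Printing Implicit Defensive.

Import Order.TTheory GRing.Theory Num.Theory.
Import numFieldNormedType.Exports.

Local Open Scope classical_set_scope.
Local Open Scope ring_scope.

(* A finite-dimensional normed space whose norm comes from a scalar product;
   positive definiteness of [dot] follows from [dotxx] and the norm axioms. *)
HB.mixin Record NormedModule_isEuclidean (R : realType) V
    & NormedModule R V & Vector R V := {
  dot : V -> V -> R;
  dotC : forall x y : V, dot x y = dot y x;
  dotDl : forall x y z : V, dot (x + y) z = dot x z + dot y z;
  dotZl : forall (a : R) (x y : V), dot (a *: x) y = a * dot x y;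
  dotxx : forall x : V, dot x x = `|x| ^+ 2 }.

#[short(type="euclideanType")]
HB.structure Definition Euclidean (R : realType) :=
  { V of NormedModule_isEuclidean R V & NormedModule R V & Vector R V }.

(* [V] with its Borel sigma-algebra. *)
Notation borel V := (g_sigma_algebraType (@open V)).

Section dual_measures.
Context {R : realType} {V : euclideanType R}.
Implicit Types (mu : {measure set (borel V) -> \bar R}) (s : V) (f : V -> R).

Definition laplace mu s : \bar R :=
  (\int[mu]_x (expR (- dot s (x : V)))%:E)%E.

Definition laplace_domain mu : set V := interior [set s | (laplace mu s < +oo)%E].

(* Only meaningful where [laplace mu] is finite, in particular on
   [laplace_domain mu]. *)
Definition log_laplace mu s : R := ln (fine (laplace mu s)).

Definition is_gradient f s (g : V) :=
  differentiable f s /\ forall v : V, 'd f s v = dot g v.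

(* The junk value 0 is returned where [f] is not differentiable. *)
Definition gradient f s : V := xget 0 (is_gradient f s).

Definition affine_hyperplane (a : V) (b : R) : set V :=
  [set x | dot a x = b].

Definition measureM mu :=
  (forall (a : V) (b : R), a != 0 -> mu (~` affine_hyperplane a b) <> 0%E) /\
  laplace_domain mu !=set0.

Definition mean_map mu s : V := - gradient (log_laplace mu) s.

Definition mean_domain mu : set V := mean_map mu @` laplace_domain mu.

Definition dual_measure (mustar mu : {measure set (borel V) -> \bar R}) :=
  [/\ measureM mu, measureM mustar,
      mean_domain mu `<=` laplace_domain mustar &
      forall s, laplace_domain mu s -> mean_map mustar (mean_map mu s) = s].

End dual_measures.

Section symmetric_matrices.
Context (R : realType) (n : nat).

Definition symv : {vspace 'M[R]_n} :=
  lker (linfun (fun A : 'M[R]_n => A^T - A)).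

Definition symmx := subvs_of symv.

HB.instance Definition _ := Vector.on symmx.

Definition mx_of_sym (x : symmx) : 'M[R]_n := vsval x.
Coercion mx_of_sym : symmx >-> matrix.

Definition symdot (x y : symmx) : R := \tr ((x : 'M[R]_n) *m (y : 'M[R]_n)).

Lemma mem_symv (A : 'M[R]_n) : (A \in symv) = (A^T == A).
Proof.
have lin : linear (fun A : 'M[R]_n => A^T - A).
  move=> a B C /=; rewrite linearD/= linearZ/= scalerBr opprD !addrA.
  congr (_ - _); rewrite -!addrA; congr (_ + _).
  by rewrite addrC.
pose L := GRing.isLinear.Build R _ _ _ _ lin.
pose F : {linear 'M[R]_n -> 'M[R]_n} := HB.pack (fun A : 'M[R]_n => A^T - A) L.
by rewrite memv_ker (lfunE F) /= subr_eq0.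
Qed.

Lemma trmx_sym (x : symmx) : (x : 'M[R]_n)^T = x.
Proof. by apply/eqP; rewrite -mem_symv subvsP. Qed.

Lemma symdotC x y : symdot x y = symdot y x.
Proof. exact: mxtrace_mulC. Qed.

Lemma symdotDl x y z : symdot (x + y) z = symdot x z + symdot y z.
Proof. by rewrite /symdot /mx_of_sym linearD/= mulmxDl mxtraceD. Qed.

Lemma symdotZl a x y : symdot (a *: x) y = a * symdot x y.
Proof. by rewrite /symdot /mx_of_sym linearZ/= -scalemxAl mxtraceZ. Qed.

Lemma symdotE x y : symdot x y =
  \sum_i \sum_j (x : 'M[R]_n) i j * (y : 'M[R]_n) i j.
Proof.
apply: eq_bigr => i _; rewrite mxE; apply: eq_bigr => j _.
by rewrite -[in y j i](trmx_sym y) mxE.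
Qed.

Lemma symdot_ge0 x : 0 <= symdot x x.
Proof.
rewrite symdotE; apply: sumr_ge0 => i _; apply: sumr_ge0 => j _.
by rewrite -expr2 sqr_ge0.
Qed.

Lemma symdot_eq0 x : symdot x x = 0 -> x = 0.
Proof.
rewrite symdotE => /eqP.
rewrite psumr_eq0 => [/allP x0|i _]; last first.
  by apply: sumr_ge0 => j _; rewrite -expr2 sqr_ge0.
apply: val_inj; apply/matrixP => i j; rewrite [RHS]mxE.
have := x0 i (mem_index_enum _); rewrite psumr_eq0 => [/allP xi0|k _]; last first.
  by rewrite -expr2 sqr_ge0.
by have := xi0 j (mem_index_enum _); rewrite -expr2 sqrf_eq0 => /eqP.
Qed.

Definition symnorm x := Num.sqrt (symdot x x).

Lemma symnormZ (a : R) x : symnorm (a *: x) = `|a| * symnorm x.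
Proof.
rewrite /symnorm symdotZl symdotC symdotZl mulrA -expr2.
by rewrite sqrtrM ?sqr_ge0// sqrtr_sqr.
Qed.

Lemma symnorm_eq0 x : symnorm x = 0 -> x = 0.
Proof.
move=> /eqP; rewrite sqrtr_eq0 => x0; apply: symdot_eq0.
by apply/eqP; rewrite eq_le x0 symdot_ge0.
Qed.

Lemma symdot_CS x y : symdot x y <= symnorm x * symnorm y.
Proof.
have [/symnorm_eq0 ->|y0] := eqVneq (symnorm y) 0.
  by rewrite symdotC -(scale0r 0) symdotZl mul0r mulr_ge0// sqrtr_ge0.
have [/symnorm_eq0 ->|x0] := eqVneq (symnorm x) 0.
  by rewrite -(scale0r 0) symdotZl mul0r mulr_ge0// sqrtr_ge0.
have xp : 0 < symnorm x by rewrite lt_def x0 sqrtr_ge0.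
have yp : 0 < symnorm y by rewrite lt_def y0 sqrtr_ge0.
have xE : symdot x x = symnorm x ^+ 2 by rewrite sqr_sqrtr// symdot_ge0.
have yE : symdot y y = symnorm y ^+ 2 by rewrite sqr_sqrtr// symdot_ge0.
have := symdot_ge0 (symnorm y *: x + (- symnorm x) *: y).
rewrite symdotDl !symdotZl ![symdot _ (_ + _)]symdotC !symdotDl !symdotZl.
rewrite (symdotC y x) xE yE.
set a := symnorm x in xp *; set b := symnorm y in yp *; set d := symdot x y.
have -> : b * (b * a ^+ 2 + - a * d) + - a * (b * d + - a * b ^+ 2) =
  2 * (a * b) * (a * b - d).
  by rewrite !mulrDr !mulNr !mulrN !opprK; ring.
by rewrite pmulr_rge0 ?subr_ge0// mulr_gt0// mulr_gt0.
Qed.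

Lemma ler_symnormD x y : symnorm (x + y) <= symnorm x + symnorm y.
Proof.
rewrite -(@ler_pXn2r _ 2%N)// ?nnegrE ?addr_ge0 ?sqrtr_ge0//.
rewrite sqrrD !sqr_sqrtr ?symdot_ge0// symdotDl ![symdot _ (_ + _)]symdotC.
rewrite !symdotDl (symdotC y x) addrA lerD2r -addrA lerD2l -mulr2n.
by rewrite lerMn2r symdot_CS orbT.
Qed.

HB.instance Definition _ :=
  Lmodule_isNormed.Build R symmx ler_symnormD symnormZ symnorm_eq0.

Lemma symdotxx (x : symmx) : symdot x x = `|x| ^+ 2.
Proof. by rewrite sqr_sqrtr// symdot_ge0. Qed.

HB.instance Definition _ := NormedModule_isEuclidean.Build R symmx
  symdotC symdotDl symdotZl symdotxx.

Definition posdef_cone : set symmx :=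
  [set x | forall u : 'rV[R]_n, u != 0 ->
             0 < (u *m (x : 'M[R]_n) *m u^T) 0 0].

Definition possemidef_cone : set symmx :=
  [set x | forall u : 'rV[R]_n, 0 <= (u *m (x : 'M[R]_n) *m u^T) 0 0].

(* [mu] is the measure mu_p, as a measure on the whole space carried by the
   cone of positive semidefinite matrices. *)
Definition wishart_measure (p : R)
    (mu : {measure set (borel symmx) -> \bar R}) :=
  mu (~` possemidef_cone) = 0%E /\
  forall s : symmx, posdef_cone s ->
    (\int[mu]_(x in possemidef_cone) (expR (- dot s (x : symmx)))%:E)%E =
    ((\det (s : 'M[R]_n) `^ p)^-1)%:E.

(* {1/2, 1, 3/2, ..., (n-1)/2} together with ](n-1)/2, +oo[ *)
Definition gindikin_set : set R :=
  [set p | exists2 k : nat, (0 < k < n)%N & p = k%:R / 2] `|`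
  [set p | (n%:R - 1) / 2 < p].

End symmetric_matrices.

(* Main.v *)
From HB Require Import structures.
Require Import Defs.
From mathcomp Require Import all_boot all_order all_algebra perm.
From mathcomp Require Import all_classical all_reals all_analysis.
From mathcomp Require Import measurable_realfun ring lra.

(** On the cone of positive definite matrices the Laplace transform of mu is
    (det s)^-p, so its logarithm is - p * ln det s.  The gradient of ln det at s
    is s^-1 ([ln_det_gradient]), so the mean map is s |-> p s^-1, which maps the
    cone into itself and is an involution: p (p s^-1)^-1 = s.

    Two points need an argument beyond this computation.

    The interior of the finiteness set of the Laplace transform must be exactly
    the cone ([laplace_domain_wishart]).  If the transform is finite at a
    symmetric s, then it is bounded on the segment from the identity to s,
    because exp(-<.,x>) is at most the sum of its values at the endpoints.  If s
    were not positive definite, the segment would leave the open cone at a point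
    where the determinant vanishes ([pdmx_segment_exit]), and (det)^-p with
    p > 0 would blow up when approaching that point.

    The measure must not be carried by a hyperplane {x | <a,x> = b}
    ([wishart_not_hyperplane]).  If it were, moving s in the direction a would
    multiply the transform by exp(-tb), hence <p s^-1, a> = b for every positive
    definite s.  As s^-1 ranges over a nonempty open cone, this affine relation
    forces a = 0.

    The facts on positive definite matrices are derived from the Cauchy-Schwarz
    inequality of the quadratic form rather than from a spectral decomposition;
    openness of the cone comes from the explicit bound |u|^2 <= tr(A^-1) uAu^T
    ([pdmx_coercive]). *)

Set Implicit Arguments.
Unset Strict Implicit.
Unset Printing Implicit Defensive.
Import Order.TTheory GRing.Theory Num.Theory.
Import numFieldNormedType.Exports.

Local Open Scope classical_set_scope.
Local Open Scope ring_scope.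

(** * Quadratic forms of symmetric matrices *)

Section quadratic_forms.
Variables (R : rcfType) (n : nat).
Implicit Types (A M : 'M[R]_n) (u w : 'rV[R]_n).

Definition bform A u w : R := (u *m A *m w^T) 0 0.
Definition qform A u : R := bform A u u.
Definition pdmx A := forall u, u != 0 -> 0 < qform A u.
Definition psdmx A := forall u, 0 <= qform A u.

Lemma bformC A u w : A^T = A -> bform A u w = bform A w u.
Proof.
move=> sA; rewrite /bform; transitivity ((u *m A *m w^T)^T 0 0).
  by rewrite [RHS]mxE.
by rewrite !trmx_mul trmxK sA mulmxA.
Qed.

Lemma bformDl A u v w : bform A (u + v) w = bform A u w + bform A v w.
Proof. by rewrite /bform !mulmxDl mxE. Qed.

Lemma bformZl A (a : R) u w : bform A (a *: u) w = a * bform A u w.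
Proof. by rewrite /bform -!scalemxAl mxE. Qed.

Lemma qformD A u w a : A^T = A ->
  qform A (a *: u + w) = a ^+ 2 * qform A u + 2 * a * bform A u w + qform A w.
Proof.
move=> sA; rewrite /qform bformDl bformZl.
rewrite (bformC u) // (bformC w) // !bformDl !bformZl (bformC w u) //; ring.
Qed.

Lemma qform_mxD A M u : qform (A + M) u = qform A u + qform M u.
Proof. by rewrite /qform /bform mulmxDr mulmxDl mxE. Qed.

Lemma qform_mxZ A a u : qform (a *: A) u = a * qform A u.
Proof. by rewrite /qform /bform -scalemxAr -scalemxAl mxE. Qed.

Lemma qform1 u : qform 1%:M u = \sum_i u 0 i ^+ 2.
Proof.
by rewrite /qform /bform mulmx1 mxE; apply: eq_bigr => i _; rewrite mxE expr2.
Qed.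

Lemma pdmx1 : pdmx 1%:M.
Proof.
move=> u; apply: contraNT; rewrite qform1 -leNgt => le0.
have /eqP : \sum_i u 0 i ^+ 2 = 0.
  by apply/eqP; rewrite eq_le le0 sumr_ge0 // => i _; rewrite sqr_ge0.
rewrite psumr_eq0 => [/allP u0|i _]; last exact: sqr_ge0.
apply/eqP/rowP => i; rewrite mxE.
by have := u0 i (mem_index_enum _); rewrite sqrf_eq0 => /eqP.
Qed.

Lemma qform1_ge0 u : 0 <= qform 1%:M u.
Proof. by rewrite qform1 sumr_ge0 // => i _; rewrite sqr_ge0. Qed.

Lemma pdmx_psd A : pdmx A -> psdmx A.
Proof.
move=> pA u; have [->|/pA/ltW//] := eqVneq u 0.
by rewrite /qform /bform mul0mx mul0mx mxE.
Qed.

(** The discriminant argument: the form is nonnegative on the combinations a u + w.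
    When it vanishes at u the combination is affine in a, so the bilinear term
    has to vanish. *)
Lemma bform_CS A u w : A^T = A -> psdmx A ->
  bform A u w ^+ 2 <= qform A u * qform A w.
Proof.
move=> sA pA.
have quad a : 0 <= a ^+ 2 * qform A u + 2 * a * bform A u w + qform A w.
  by rewrite -qformD.
have := pA u; rewrite le_eqVlt => /predU1P[q0|qu]; last first.
  (* the minimiser of the quadratic polynomial in a *)
  have := quad (- bform A u w / qform A u).
  have -> : (- bform A u w / qform A u) ^+ 2 * qform A u +
      2 * (- bform A u w / qform A u) * bform A u w + qform A w =
      (qform A u * qform A w - bform A u w ^+ 2) / qform A u.
    by field; rewrite gt_eqF.
  by rewrite pmulr_lge0 ?invr_gt0 // subr_ge0.
rewrite -q0 mul0r.
have [->|B0] := eqVneq (bform A u w) 0; first by rewrite expr0n.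
(* this value of a makes the affine function equal to -1 *)
have := quad (- (qform A w + 1) / bform A u w / 2).
rewrite -q0 mulr0 add0r.
have -> : 2 * (- (qform A w + 1) / bform A u w / 2) * bform A u w + qform A w = -1.
  by field.
by rewrite ler0N1.
Qed.

Lemma mulmx_tr_eq0 (v : 'rV[R]_n) : (forall w, (v *m w^T) 0 0 = 0) -> v = 0.
Proof.
move=> v0; apply/eqP; apply: contraT => /pdmx1.
by rewrite /qform /bform mulmx1 v0 ltxx.
Qed.

(** By Cauchy-Schwarz u is then orthogonal to every w for the bilinear form of A. *)
Lemma psdmx_ker A u : A^T = A -> psdmx A -> qform A u = 0 -> u *m A = 0.
Proof.
move=> sA pA q0; apply: mulmx_tr_eq0 => w.
have := bform_CS u w sA pA; rewrite q0 mul0r => le0.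
by apply/eqP; rewrite -sqrf_eq0 eq_le le0 sqr_ge0.
Qed.

Lemma pdmx_unit A : pdmx A -> A \in unitmx.
Proof.
move=> pA; rewrite unitmxE unitfE; apply/negP => /det0P[u u0 uA].
by have := pA u u0; rewrite /qform /bform uA mul0mx mxE ltxx.
Qed.

Lemma psdmx_det0 A : A^T = A -> psdmx A -> ~ pdmx A -> \det A = 0.
Proof.
move=> sA psA npA; apply/eqP; apply: contra_notT npA => detA u u0.
rewrite lt_def psA andbT; apply: contraNneq u0 => /(psdmx_ker sA psA) uA.
by rewrite -(mulmxK (_ : A \in unitmx) u) ?uA ?mul0mx // unitmxE unitfE.
Qed.

Lemma trmx_inv_sym A : A^T = A -> (invmx A)^T = invmx A.
Proof. by rewrite trmx_inv => ->. Qed.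

Lemma pdmxV A : A^T = A -> pdmx A -> pdmx (invmx A).
Proof.
move=> sA pA u u0; have uA := pdmx_unit pA.
suff -> : qform (invmx A) u = qform A (u *m invmx A).
  apply: pA; apply: contraNneq u0 => v0.
  by rewrite -(mulmxKV uA u) v0 mul0mx.
by rewrite /qform /bform mulmxKV // trmx_mul trmx_inv_sym // mulmxA.
Qed.

(** A quantitative form of definiteness that needs no eigenvalues: Cauchy-Schwarz
    for u and e_i A^-1 bounds u_i^2 by (A^-1)_ii times the form at u, and these
    bounds are summed over i. *)
Lemma pdmx_coercive A u : A^T = A -> pdmx A ->
  qform 1%:M u <= \tr (invmx A) * qform A u.
Proof.
move=> sA pA; have uA := pdmx_unit pA.
rewrite qform1 /mxtrace mulr_suml; apply: ler_sum => i _.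
pose w : 'rV[R]_n := delta_mx 0 i *m invmx A.
have <- : bform A u w = u 0 i.
  rewrite /bform trmx_mul trmx_inv_sym // mulmxA mulmxK // trmx_delta.
  by rewrite -colE mxE.
have <- : qform A w = invmx A i i.
  rewrite /qform /bform mulmxKV // trmx_mul trmx_inv_sym // mulmxA.
  by rewrite -rowE trmx_delta -colE !mxE.
by rewrite mulrC bform_CS //; exact: pdmx_psd.
Qed.

(** Coercivity absorbs a perturbation that is small with respect to the
    Euclidean form; this makes the positive definite cone open. *)
Lemma pdmx_perturb A M c : A^T = A -> pdmx A ->
  (forall u, `|qform M u| <= c * qform 1%:M u) -> c * \tr (invmx A) < 1 ->
  pdmx (A + M).
Proof.
move=> sA pA Mc cA u u0; rewrite qform_mxD.
have qA := pA u u0; have q1 := pdmx1 u0; have coe := pdmx_coercive u sA pA.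
have := Mc u; rewrite ler_norml => /andP[+ _].
have c0 : 0 <= c.
  by have := le_trans (normr_ge0 _) (Mc u); rewrite pmulr_lge0.
have : c * qform 1%:M u <= c * (\tr (invmx A) * qform A u) by rewrite ler_wpM2l.
have : c * \tr (invmx A) * qform A u < 1 * qform A u by rewrite ltr_pM2r.
rewrite mulrA; lra.
Qed.

Lemma pdmx_segment M a b : 0 <= a <= b -> pdmx (1%:M + b *: M) ->
  pdmx (1%:M + a *: M).
Proof.
move=> /andP[a0 ab] pb u u0; have := pb u u0; have := pdmx1 u0.
rewrite !qform_mxD !qform_mxZ; set q := qform 1%:M u; set m := qform M u.
move=> q0 qb; have [m0|m0] := leP 0 m.
  by rewrite ltr_wpDr // mulr_ge0.
by have : b * m <= a * m by [rewrite ler_wnM2r // ltW]; lra.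
Qed.

(** The polynomial t |-> det(1 + tM), obtained by reversing the coefficients of
    the characteristic polynomial of -M: det(1 + tM) = t^n det(1/t + M). *)
Definition det_path M : {poly R} :=
  \poly_(k < n.+1) (char_poly (- M))`_(n - k).

Lemma horner_char_polyN M x : (char_poly (- M)).[x] = \det (x%:M + M).
Proof.
rewrite /char_poly -horner_evalE -det_map_mx; congr (\det _).
apply/matrixP => i j; rewrite !mxE /= horner_evalE !hornerE.
by case: (i == j); rewrite /= ?mulr1n ?mulr0n ?hornerX ?horner0 opprK.
Qed.

Lemma horner_det_path M t : (det_path M).[t] = \det (1%:M + t *: M).
Proof.
rewrite /det_path horner_poly; have [->|t0] := eqVneq t 0.
  rewrite scale0r addr0 det1 big_ord_recl /= expr0 mulr1 subn0 big1 ?addr0.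
    have /monicP := char_poly_monic (- M).
    by rewrite lead_coefE size_char_poly.
  by move=> i _; rewrite exprS mul0r mulr0.
have -> : 1%:M + t *: M = t *: (t^-1%:M + M).
  by rewrite scalerDr scale_scalar_mx divff.
rewrite detZ -horner_char_polyN horner_coef size_char_poly mulr_sumr.
rewrite (reindex_inj rev_ord_inj) /=; apply: eq_bigr => i _.
rewrite subSS subKn ?leq_ord // exprVn mulrCA; congr (_ * _).
by rewrite expfB_cond // (negPf t0) leq_ord.
Qed.

(** The derivative of the determinant at the identity is the trace. *)
Lemma coef1_det_path M : (0 < n)%N -> (det_path M)`_1 = \tr M.
Proof.
move=> n0; rewrite coef_poly ltnS n0 subn1 char_poly_trace //.
by rewrite raddfN opprK.
Qed.

(** The determinant is 1 at the identity and does not vanish on the segment from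
    the identity to A, so the intermediate value theorem fixes its sign at A. *)
Lemma pdmx_det_gt0 A : pdmx A -> 0 < \det A.
Proof.
move=> pA; rewrite ltNge; apply/negP => detA.
pose P := det_path (A - 1%:M).
have P1 : P.[1] = \det A by rewrite horner_det_path scale1r addrC subrK.
have P0 : P.[0] = 1 by rewrite horner_det_path scale0r addr0 det1.
have [|t /andP[t0 t1]] := @poly_ivt _ (- P) 0 1 ler01.
  by rewrite !hornerN P0 P1 lerN10 oppr_ge0.
rewrite rootN rootE horner_det_path; apply/negP.
rewrite -unitfE -unitmxE pdmx_unit //.
apply: (@pdmx_segment _ t 1); first by rewrite t0.
by rewrite scale1r addrC subrK.
Qed.

End quadratic_forms.

(** * Scalar products and gradients *)

Section euclidean.
Variables (R : realType) (V : euclideanType R).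
Implicit Types (f : V -> R) (s g : V).

Lemma dotDr (x y z : V) : dot x (y + z) = dot x y + dot x z.
Proof. by rewrite dotC dotDl !(dotC _ x). Qed.

Lemma dotZr a (x y : V) : dot x (a *: y) = a * dot x y.
Proof. by rewrite dotC dotZl dotC. Qed.

Lemma dot_eq0 (x : V) : (forall y, dot x y = 0) -> x = 0.
Proof.
by move=> /(_ x) /eqP; rewrite dotxx expf_eq0 /= normr_eq0 => /eqP.
Qed.

Lemma gradient_unique f s g : is_gradient f s g -> gradient f s = g.
Proof.
move=> fg; apply: xget_unique => // h [_ fh].
apply/eqP; rewrite -subr_eq0; apply/eqP/dot_eq0 => y.
case: fg => _ fg.
by rewrite dotDl -scaleN1r dotZl -fg -fh mulN1r subrr.
Qed.

(** Differentiability is local; the logarithm of the Laplace transform agrees with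
    - p ln det only on the cone. *)
Lemma differentiable_near f h s : (\forall t \near s, f t = h t) ->
  differentiable h s -> differentiable f s /\ 'd f s = 'd h s :> (V -> R).
Proof.
move=> fh dh.
have fhs : f s = h s by apply: (nbhs_singleton fh).
have fE : f \o shift s = cst (f s) + 'd h s +o_ (0 : V) id.
  have /eqaddoP hE := diff_locally dh.
  apply/eqaddoP => e e0; have := hE e e0.
  have /nbhs0P := fh; apply: filterS2 => x fx.
  by rewrite !fctE /shift /= fhs [x + s]addrC fx.
have dE := diff_unique (diff_continuous dh) fE.
split=> //; apply/diff_locallyP; rewrite dE; split=> //.
exact: diff_continuous.
Qed.

Lemma polarization (x y : V) :
  dot x y = (`|x + y| ^+ 2 - `|x| ^+ 2 - `|y| ^+ 2) / 2.
Proof. by rewrite -!dotxx dotDl !dotDr (dotC y x); field. Qed.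

(** Cauchy-Schwarz in the form of the triangle inequality, through polarization. *)
Lemma ler_dot (x y : V) : `|dot x y| <= `|x| * `|y|.
Proof.
have CS z : dot z y <= `|z| * `|y|.
  have : `|z + y| ^+ 2 <= (`|z| + `|y|) ^+ 2.
    by rewrite lerXn2r ?nnegrE ?ler_normD ?addr_ge0.
  rewrite polarization; set r := `|z + y|; set a := `|z|; set b := `|y|; nra.
rewrite ler_norml CS andbT lerNl -mulN1r -dotZl scaleN1r -(normrN x).
exact: CS.
Qed.

Lemma dot_is_linear (x : V) : linear (dot x : V -> R^o).
Proof. by move=> a y z; rewrite dotDr dotZr. Qed.

HB.instance Definition _ (x : V) :=
  GRing.isLinear.Build R V R^o *:%R (dot x) (dot_is_linear x).

Lemma dot_continuous (x : V) : continuous (dot x : V -> R^o).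
Proof.
apply: bounded_linear_continuous; apply/linear_boundedP.
near=> r => y; apply: le_trans (ler_dot x y) _.
by rewrite ler_wpM2r.
Unshelve. all: by end_near. Qed.

Lemma dot_differentiable (x s : V) : differentiable (dot x : V -> R^o) s.
Proof. exact/linear_differentiable/dot_continuous. Qed.

End euclidean.

(** * The space of symmetric matrices *)

Section symmetric.
Variables (R : realType) (n : nat).
Implicit Types (x s : symmx R n) (u : 'rV[R]_n) (A : 'M[R]_n).

Definition sym_of A : symmx R n := vsproj (symv R n) A.

Lemma sym_ofK A : A^T = A -> (sym_of A : 'M[R]_n) = A.
Proof. by move=> sA; rewrite /mx_of_sym vsprojK // mem_symv sA. Qed.

Lemma symD x s : (x + s : symmx R n) = (x : 'M[R]_n) + s :> 'M[R]_n.
Proof. by rewrite /mx_of_sym linearD. Qed.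

Lemma symZ a x : (a *: x : symmx R n) = a *: (x : 'M[R]_n) :> 'M[R]_n.
Proof. by rewrite /mx_of_sym linearZ. Qed.

Lemma sym_inj x s : (x : 'M[R]_n) = s -> x = s.
Proof. exact: val_inj. Qed.

Lemma sym_dotE x s : dot x s = \tr ((x : 'M[R]_n) *m (s : 'M[R]_n)).
Proof. by []. Qed.

(** The quadratic form of x at u is linear in x, which is what links the cones to
    the Euclidean structure of the space of symmetric matrices. *)
Lemma qform_rank1 x u : qform x u = dot x (sym_of (u^T *m u)).
Proof.
rewrite sym_dotE sym_ofK ?trmx_mul ?trmxK // mulmxA mxtrace_mulC mulmxA.
by rewrite /mxtrace big_ord1.
Qed.

Lemma norm_rank1 u : `|sym_of (u^T *m u)| = qform 1%:M u.
Proof.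
apply/eqP; rewrite -(@eqrXn2 _ 2) ?qform1_ge0 // -dotxx -qform_rank1.
rewrite sym_ofK ?trmx_mul ?trmxK // /qform /bform mulmx1 -!mulmxA mulmxA.
by rewrite mxE big_ord1 expr2.
Qed.

Lemma ler_qform x u : `|qform x u| <= `|x| * qform 1%:M u.
Proof. by rewrite qform_rank1 -norm_rank1 ler_dot. Qed.

Lemma posdef_coneE x : posdef_cone x = pdmx (mx_of_sym x).
Proof. by []. Qed.

(** Entries are scalar products, hence differentiable functions of the matrix. *)
Lemma entry_dot i j x :
  (x : 'M[R]_n) i j = dot (sym_of (2^-1 *: (delta_mx i j + delta_mx j i))) x.
Proof.
rewrite dotC sym_dotE sym_ofK; last first.
  by rewrite linearZ linearD /= !trmx_delta addrC.
have tr_delta k l : \tr ((x : 'M[R]_n) *m delta_mx k l) = (x : 'M[R]_n) l k.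
  rewrite /mxtrace (bigD1 l) //= big1 => [|m ml]; last first.
    by rewrite mxE big1 // => q _; rewrite mxE (negPf ml) andbF mulr0.
  rewrite addr0 mxE (bigD1 k) //= big1 => [|m mk]; last first.
    by rewrite mxE (negPf mk) mulr0.
  by rewrite mxE !eqxx mulr1 addr0.
rewrite -scalemxAr mulmxDr mxtraceZ mxtraceD !tr_delta.
have -> : (x : 'M[R]_n) j i = (x : 'M[R]_n) i j.
  by rewrite -[in LHS](trmx_sym x) mxE.
by field.
Qed.

Lemma open_posdef : open (@posdef_cone R n).
Proof.
rewrite openE => x px; apply/nbhs0P.
have [e e0 xe] : exists2 e : R, 0 < e & e * \tr (invmx (mx_of_sym x)) < 1.
  pose c := `|\tr (invmx (mx_of_sym x))| + 1.
  have c0 : 0 < c by rewrite ltr_wpDl.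
  exists c^-1; first by rewrite invr_gt0.
  rewrite mulrC ltr_pdivrMr // mul1r.
  by rewrite (le_lt_trans (ler_norm _)) // ltrDl.
near=> h; rewrite posdef_coneE symD.
apply: (@pdmx_perturb _ _ _ _ e) => //; first exact: trmx_sym.
move=> u; apply: le_trans (ler_qform h u) _.
by rewrite ler_wpM2r ?qform1_ge0.
Unshelve. all: by end_near. Qed.

Lemma closed_possemidef : closed (@possemidef_cone R n).
Proof.
have -> : @possemidef_cone R n =
    \bigcap_(u : 'rV[R]_n) [set x | 0 <= dot (sym_of (u^T *m u)) x].
  apply/seteqP; split=> [x px u _ /=|x px u].
    by rewrite dotC -qform_rank1; exact: px.
  by have := px u I; rewrite /= dotC -qform_rank1.
apply: closed_bigI => u _.
apply: (@preimage_closed _ _ (dot (sym_of (u^T *m u)) : symmx R n -> R^o)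
  [set y | 0 <= y]).
  by move=> x _; exact: dot_continuous.
exact: closed_ge.
Qed.

Lemma det_differentiable s :
  differentiable (fun x : symmx R n => \det (mx_of_sym x) : R^o) s.
Proof.
pose F (t : 'S_n) i x : R^o := mx_of_sym x i (t i).
have -> : (fun x : symmx R n => \det (mx_of_sym x) : R^o) =
    \sum_(t : 'S_n) (cst ((-1) ^+ t : R^o) * \prod_i F t i).
  apply/funext => x; rewrite fct_sumE /determinant; apply: eq_bigr => t _.
  by rewrite !fctE fct_prodE.
apply: (big_ind (fun f => differentiable f s)) => [||t _].
- exact: differentiable_cst.
- by move=> f g; exact: differentiableD.
apply: differentiableM; first exact: differentiable_cst.
apply: (big_ind (fun f => differentiable f s)) => [||i _].
- exact: differentiable_cst.
- by move=> f g; exact: differentiableM.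
rewrite (_ : F t i =
    dot (sym_of (2^-1 *: (delta_mx i (t i) + delta_mx (t i) i)))).
  exact: dot_differentiable.
by apply/funext => x; rewrite -entry_dot.
Qed.

(** Jacobi's formula at a positive definite s: the directional derivative is the
    linear coefficient of t |-> det(s) det(1 + t s^-1 v). *)
Lemma diff_det s v : (0 < n)%N -> posdef_cone s ->
  'd (fun x : symmx R n => \det (mx_of_sym x) : R^o) s v =
  \det (mx_of_sym s) * \tr (invmx (mx_of_sym s) *m mx_of_sym v).
Proof.
move=> n0 ps; have us := pdmx_unit ps.
rewrite -deriveE; last exact: det_differentiable.
pose M := invmx (mx_of_sym s) *m mx_of_sym v.
pose P := \det (mx_of_sym s) *: det_path M.
have PE t : P.[t] = \det (mx_of_sym (t *: v + s)).
  rewrite hornerZ horner_det_path -det_mulmx mulmxDr mulmx1 -scalemxAr.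
  by rewrite mulKVmx // symD symZ addrC.
transitivity ('D_1 (horner P) 0 : R).
  apply: (congr1 (fun k : R -> R^o => lim (k @ 0^'))).
  have Ps : \det (mx_of_sym s) = P.[0] by rewrite PE scale0r add0r.
  apply/funext => h; rewrite /= addr0 -PE Ps.
  by rewrite [h *: 1]mulr1.
have -> : 'D_1 (horner P) 0 = P^`().[0] by have [] := is_derive_poly P 0.
by rewrite horner_coef0 coef_deriv mulr1n coefZ coef1_det_path.
Qed.

Lemma ln_det_gradient s : (0 < n)%N -> posdef_cone s ->
  is_gradient (fun x : symmx R n => ln (\det (mx_of_sym x))) s
    (sym_of (invmx (mx_of_sym s))).
Proof.
move=> n0 ps; have det0 := pdmx_det_gt0 ps.
have dln : differentiable (@ln R : R -> R^o) (\det (mx_of_sym s)).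
  by apply/derivable1_diffP; exact: (@ex_derive _ _ _ _ _ _ _ (is_derive1_ln det0)).
have ddet := det_differentiable s.
split.
  exact: (@differentiable_comp _ _ _ _ _ (@ln R : R -> R^o)).
move=> v.
have -> := @diff_comp _ _ _ _ _ (@ln R : R -> R^o) s ddet dln.
rewrite /= diff_det // deriv1E; last by apply: ex_derive; exact: is_derive1_ln.
rewrite derive1E (@derive_val _ _ _ _ _ _ _ (is_derive1_ln det0)).
rewrite sym_dotE sym_ofK; last by apply: trmx_inv_sym; exact: trmx_sym.
rewrite /GRing.scale /= mulrAC mulfV ?mul1r // gt_eqF //.
Qed.

End symmetric.

(** * Laplace transforms *)

Section laplace_transform.
Variables (R : realType) (V : euclideanType R).
Variable mu : {measure set (borel V) -> \bar R}.
Implicit Types (s a : V) (t b : R).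

Lemma open_borel (U : set V) : open U -> measurable (U : set (borel V)).
Proof. exact: sub_sigma_algebra. Qed.

Lemma continuous_borel (f : V -> R) : continuous f ->
  measurable_fun [set: borel V] (f : borel V -> R).
Proof.
move=> /continuousP cf; apply: (measurability _ (RGenOpens.measurableE R)).
move=> _ [_ [x [y ->] <-]]; rewrite setTI; apply: open_borel.
exact/cf/interval_open.
Qed.

(** The integrand is continuous, hence Borel. *)
Lemma measurable_laplace s :
  measurable_fun [set: borel V] (fun x : borel V => (expR (- dot s (x : V)))%:E).
Proof.
apply/measurable_EFinP; apply: measurableT_comp; first exact: measurable_expR.
apply: measurable_funN => /=.
exact: (continuous_borel (@dot_continuous _ _ s)).
Qed.

(** At each x the linear form is at least the smaller of its endpoint values, so
    exp(-<.,x>) is at most the larger of its endpoint values, and a fortiori at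
    most their sum. *)
Lemma laplace_segment s1 s2 t : 0 <= t <= 1 ->
  (laplace mu (s1 + t *: (s2 - s1))%R <= laplace mu s1 + laplace mu s2)%E.
Proof.
move=> /andP[t0 t1]; rewrite /laplace -ge0_integralD //; last 2 first.
- exact: measurable_laplace.
- exact: measurable_laplace.
apply: ge0_le_integral => //.
- exact: measurable_laplace.
- by apply: emeasurable_funD; exact: measurable_laplace.
move=> x _; rewrite lee_fin dotDl dotZl dotDl -[- s1]scaleN1r dotZl.
set u := dot s1 x; set v := dot s2 x.
have [uv|vu] := leP u v.
  apply: le_trans (_ : expR (- u) <= _); last by rewrite lerDl expR_ge0.
  rewrite ler_expR; nra.
apply: le_trans (_ : expR (- v) <= _); last by rewrite lerDr expR_ge0.
rewrite ler_expR; nra.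
Qed.

(** Translating by t a multiplies the integrand by exp(-tb) on the hyperplane, which
    carries the whole measure. *)
Lemma laplace_hyperplane a b s t : mu (~` affine_hyperplane a b) = 0%E ->
  laplace mu (s + t *: a)%R = ((expR (- (t * b)))%:E * laplace mu s)%E.
Proof.
move=> mu0; rewrite /laplace -ge0_integralZl_EFin ?expR_ge0 //;
  last exact: measurable_laplace.
have mN : measurable (~` affine_hyperplane a b : set (borel V)).
  apply: open_borel; apply: closed_openC.
  apply: (@preimage_closed _ _ (dot a : V -> R^o) [set b]).
    by move=> x _; exact: dot_continuous.
  exact: closed_eq.
rewrite [LHS](ge0_negligible_integral mN) //; last exact: measurable_laplace.
rewrite [RHS](ge0_negligible_integral mN) //; last first.
  by apply: measurable_funeM; exact: measurable_laplace.
apply: eq_integral => x; rewrite inE /= => -[_ /contrapT] axb.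
by rewrite dotDl dotZl axb -EFinM -expRD opprD addrC.
Qed.

End laplace_transform.

(** * Segments leaving the positive definite cone *)

Section segment_exit.
Variables (R : realType) (n : nat).
Implicit Types (A M : 'M[R]_n) (d : R).

Lemma pdmx_ray A M d : A^T = A -> M^T = M -> pdmx A -> 0 < d ->
  exists2 e, 0 < e <= d & pdmx (A + e *: M).
Proof.
move=> sA sM pA d0; pose K := `|sym_of M| * `|\tr (invmx A)| + 1.
have K0 : 0 < K by rewrite ltr_wpDl // mulr_ge0.
exists (Num.min d K^-1); first by rewrite lt_min d0 invr_gt0 K0 ge_min lexx.
set e := Num.min _ _.
have e0 : 0 < e by rewrite lt_min d0 invr_gt0.
apply: (@pdmx_perturb _ _ _ _ (e * `|sym_of M|)) => // [u|].
  rewrite qform_mxZ normrM gtr0_norm // -mulrA ler_wpM2l ?(ltW e0) //.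
  by rewrite -[in leLHS](sym_ofK sM) ler_qform.
apply: le_lt_trans (_ : K^-1 * (`|sym_of M| * `|\tr (invmx A)|) < 1).
  rewrite -mulrA; apply: le_trans (_ : e * (`|sym_of M| * `|\tr (invmx A)|) <= _).
    by rewrite ler_wpM2l ?(ltW e0) // ler_wpM2l // ler_norm.
  by rewrite ler_wpM2r ?mulr_ge0 // ge_min lexx orbT.
by rewrite mulrC ltr_pdivrMr // mul1r ltrDl.
Qed.

(** With t0 the supremum of the parameters in [0, 1] whose point is positive
    definite, the point at t0 is positive semidefinite as a limit and not positive
    definite by openness, so it is singular. *)
Lemma pdmx_segment_exit M : M^T = M -> ~ pdmx (1%:M + M) ->
  exists2 t0 : R, 0 < t0 & \det (1%:M + t0 *: M) = 0 /\
    forall t, 0 <= t < t0 -> t <= 1 /\ pdmx (1%:M + t *: M).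
Proof.
move=> sM nM; have symt t : (1%:M + t *: M)^T = 1%:M + t *: M.
  by rewrite linearD linearZ /= sM trmx1.
pose T := [set t : R | 0 <= t <= 1 /\ pdmx (1%:M + t *: M)].
have T0 : T 0 by split; [rewrite lexx ler01 | rewrite scale0r addr0; exact: pdmx1].
have T1 : ubound T 1 by move=> t [/andP[]].
have sup0 : 0 <= sup T by apply: ub_le_sup T0; exists 1.
have sup1 : sup T <= 1 by apply: ge_sup => //; exists 0.
have psd : psdmx (1%:M + sup T *: M).
  move=> u; rewrite qform_mxD qform_mxZ leNgt; apply/negP => lt0.
  have q0 := qform1_ge0 u.
  have m0 : qform M u < 0 by nra.
  have : sup T <= qform 1%:M u / - qform M u.
    (* along u the form is affine in t; it is negative at the supremum, so its zero
       is an upper bound strictly below the supremum *)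
    apply: ge_sup; first by exists 0.
    move=> t [_ /pdmx_psd/(_ u)]; rewrite qform_mxD qform_mxZ.
    by rewrite ler_pdivlMr ?oppr_gt0 //; lra.
  by rewrite ler_pdivlMr ?oppr_gt0 //; lra.
have npd : ~ pdmx (1%:M + sup T *: M).
  move=> pd; have : sup T != 1.
    by apply/eqP => s1; apply: nM; move: pd; rewrite s1 scale1r.
  move=> neq; have d0 : 0 < 1 - sup T by rewrite subr_gt0 lt_def eq_sym neq.
  have [e /andP[e0 ed]] := pdmx_ray (symt _) sM pd d0.
  rewrite -addrA -scalerDl => pe.
  have : sup T + e <= sup T.
    apply: ub_le_sup; first by exists 1.
    by split=> //; apply/andP; split; lra.
  by rewrite gerDl leNgt e0.
have det0 := psdmx_det0 (symt _) psd npd.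
exists (sup T); last split => //.
  rewrite lt_def sup0 andbT; apply/eqP => s0; move: det0.
  by rewrite s0 scale0r addr0 det1 => /eqP; rewrite oner_eq0.
move=> t /andP[t0 tT]; split; first by rewrite (le_trans (ltW tT)).
have [|t' [_ pt'] tt'] := sup_gt _ tT; first by exists 0.
by apply: pdmx_segment pt'; rewrite t0 ltW.
Qed.

End segment_exit.

(** * The Wishart measure *)

Section wishart.
Variables (R : realType) (n : nat) (p : R).
Variable mu : {measure set (borel (symmx R n)) -> \bar R}.
Hypotheses (n0 : (0 < n)%N) (p0 : 0 < p) (hmu : wishart_measure p mu).
Implicit Types (s a : symmx R n) (b : R).

Lemma laplace_wishart s : posdef_cone s ->
  laplace mu s = ((\det (mx_of_sym s) `^ p)^-1)%:E.
Proof.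
move=> ps; case: hmu => mu0 /(_ s ps) <-.
rewrite /laplace (ge0_negligible_integral _ _ _ _ mu0) //; last first.
- exact: measurable_laplace.
- by apply: open_borel; apply: closed_openC; exact: closed_possemidef.
by rewrite setTD setCK.
Qed.

Let one : symmx R n := sym_of 1%:M.

Lemma oneE : mx_of_sym one = 1%:M.
Proof. by rewrite sym_ofK ?trmx1. Qed.

Lemma posdef_one : posdef_cone one.
Proof. by rewrite posdef_coneE oneE; exact: pdmx1. Qed.

(** Along the segment from the identity to s the transform (det)^-p stays bounded,
    whereas the determinant tends to 0 where the segment leaves the cone. *)
Lemma laplace_fin_posdef s : (laplace mu s < +oo)%E -> posdef_cone s.
Proof.
move=> Ls; apply: contrapT => ns.
pose M := mx_of_sym s - 1%:M; have sM : M^T = M.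
  by rewrite linearB /= trmx_sym trmx1.
have [|t0 t00 [det0 seg]] := pdmx_segment_exit sM.
  by rewrite addrC subrK.
pose st t : symmx R n := one + t *: (s - one).
have stE t : mx_of_sym (st t) = 1%:M + t *: M.
  by rewrite symD symZ symD -scaleN1r symZ scaleN1r oneE.
have [C C0 LC] : exists2 C, 0 <= C & forall t, 0 <= t < t0 ->
    ((\det (1%:M + t *: M) `^ p)^-1 <= C).
  have fs : laplace mu s \is a fin_num.
    by rewrite ge0_fin_numE // integral_ge0.
  have L1 := laplace_wishart posdef_one; rewrite oneE det1 powR1 invr1 in L1.
  exists (1 + fine (laplace mu s)).
    by rewrite addr_ge0 // fine_ge0 // integral_ge0.
  move=> t /[dup] /andP[t0' _] /seg[t1 pt].
  have tt : 0 <= t <= 1 by rewrite t0'.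
  have pst : posdef_cone (st t).
    by rewrite posdef_coneE stE.
  have := laplace_segment mu one s tt.
  rewrite L1 -/(st t) laplace_wishart // stE.
  by rewrite -(fineK fs) -EFinD lee_fin.
(* a determinant below c makes (det)^-p exceed C + 1 *)
pose c := (C + 1)^-1 `^ p^-1.
have C1 : 0 < C + 1 by rewrite ltr_wpDl.
have c0 : 0 < c by rewrite powR_gt0 // invr_gt0.
have [t tt ct] : exists2 t, 0 <= t < t0 & (det_path M).[t] < c.
  have ctn : \forall t \near t0, (det_path M).[t] < c.
    have := @continuous_horner _ (det_path M) t0.
    rewrite /continuous_at horner_det_path det0 => /cvgr_lt; apply.
    exact: c0.
  near (t0^'-) => t; exists t; last by near: t; exact: cvg_within ctn.
  by apply/andP; split; near: t; [exact: nbhs_left_ge|exact: nbhs_left_lt].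
rewrite horner_det_path in ct; have pt := pdmx_det_gt0 (seg t tt).2.
have := LC t tt; apply/negP; rewrite -ltNge.
have : \det (1%:M + t *: M) `^ p < c `^ p.
  by rewrite gt0_ltr_powR // nnegrE ltW.
rewrite -powRrM mulVf ?gt_eqF // powRr1 ?invr_ge0 ?(ltW C1) // => lt1.
apply: lt_trans (_ : C + 1 < _); first by rewrite ltrDl.
by rewrite -[ltLHS]invrK ltf_pV2 ?posrE ?powR_gt0 ?invr_gt0.
Unshelve. all: by end_near. Qed.

Lemma laplace_domain_wishart : laplace_domain mu = @posdef_cone R n.
Proof.
apply/seteqP; split=> [s /interior_subset|]; first exact: laplace_fin_posdef.
rewrite -open_subsetE; last exact: open_posdef.
by move=> s ps /=; rewrite laplace_wishart // ltry.
Qed.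

Lemma log_laplace_wishart s : posdef_cone s ->
  log_laplace mu s = - p * ln (\det (mx_of_sym s)).
Proof.
move=> ps; rewrite /log_laplace laplace_wishart //= lnV ?ln_powR ?mulNr //.
by rewrite posrE powR_gt0 // pdmx_det_gt0.
Qed.

Lemma log_laplace_gradient s : posdef_cone s ->
  is_gradient (log_laplace mu) s (- (p *: sym_of (invmx (mx_of_sym s)))).
Proof.
move=> ps; have [dl gl] := ln_det_gradient n0 ps.
pose h : symmx R n -> R^o :=
  - p *: (fun x : symmx R n => ln (\det (mx_of_sym x)) : R^o).
have dh : differentiable h s by exact: differentiableZ.
have [|df dE] := @differentiable_near _ _ (log_laplace mu) h s _ dh.
  near=> x; apply: log_laplace_wishart; near: x.
  exact: open_nbhs_nbhs (conj (@open_posdef R n) ps).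
split=> // v; transitivity ('d h s v : R); first exact: (congr1 (@^~ v) dE).
by rewrite diffZ // -scaleNr dotZl -gl.
Unshelve. all: by end_near. Qed.

Lemma mean_map_wishart s : posdef_cone s ->
  mean_map mu s = p *: sym_of (invmx (mx_of_sym s)).
Proof.
move=> ps; rewrite /mean_map.
by rewrite (gradient_unique (log_laplace_gradient ps)) opprK.
Qed.

(** By translation along a, the logarithm of the transform is affine in t with
    slope -b; this slope is also the scalar product of a with the gradient. *)
Lemma hyperplane_mean a b s : mu (~` affine_hyperplane a b) = 0%E ->
  posdef_cone s -> dot (mean_map mu s) a = b.
Proof.
move=> mu0 ps; have [df gf] := log_laplace_gradient ps.
rewrite mean_map_wishart //; apply: oppr_inj.
rewrite -mulN1r -dotZl scaleN1r -gf -deriveE // /derive.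
have fh h : log_laplace mu (h *: a + s) - log_laplace mu s = - (h * b).
  rewrite [h *: a + s]addrC /log_laplace.
  rewrite (laplace_hyperplane _ _ mu0) laplace_wishart //.
  rewrite -EFinM /= lnM ?posrE ?expR_gt0 ?invr_gt0 ?powR_gt0 ?pdmx_det_gt0 //.
  by rewrite expRK addrK.
apply: cvg_lim => //; apply: (@cvg_near_cst _ _ (- b)).
near=> h; rewrite /= fh -mulrN /GRing.scale /= mulKf //.
by near: h; exact: nbhs_dnbhs_neq.
Unshelve. all: by end_near. Qed.

(** The relation p <x,a> = b holds for every positive definite x, inverses of
    positive definite matrices being all of them.  At the identity and at
    twice the identity it gives <1,a> = b = 0, and at 1 + e a, for a small e > 0,
    it then gives <a,a> = 0. *)
Lemma wishart_not_hyperplane a b : a != 0 ->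
  mu (~` affine_hyperplane a b) <> 0%E.
Proof.
move=> a0 mu0.
have inv_mean x s : posdef_cone x -> mx_of_sym s = invmx (mx_of_sym x) ->
    p * dot x a = b.
  move=> px sx.
  have ps : posdef_cone s.
    by rewrite posdef_coneE sx; apply: pdmxV => //; exact: trmx_sym.
  rewrite -(hyperplane_mean mu0 ps) mean_map_wishart // sx invmxK dotZl.
  by congr (_ * dot _ _); apply: sym_inj; rewrite sym_ofK // trmx_sym.
have mean x : posdef_cone x -> p * dot x a = b.
  move=> px; apply: (inv_mean x (sym_of (invmx (mx_of_sym x)))) => //.
  by rewrite sym_ofK // trmx_inv_sym // trmx_sym.
have cone2 : posdef_cone (2 *: one).
  move=> u u0; rewrite -/(bform _ _ _) -/(qform _ _) symZ qform_mxZ.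
  by rewrite mulr_gt0 //; exact: posdef_one.
have b1 := mean _ posdef_one; have b2 := mean _ cone2.
have sa : (mx_of_sym a)^T = a by exact: trmx_sym.
have [e /andP[e0 _] pe] := pdmx_ray (@trmx1 R n) sa (@pdmx1 R n) ltr01.
have b3 : p * dot (one + e *: a) a = b.
  by apply: mean; rewrite posdef_coneE symD symZ oneE.
move: a0; rewrite -normr_gt0 => /(exprn_gt0 2); rewrite -dotxx.
move: b1 b2 b3; rewrite dotDl !dotZl => b1 b2 b3 aa.
have : 0 < p * (e * dot a a) by rewrite !mulr_gt0.
nra.
Qed.

Lemma wishart_measureM : measureM mu.
Proof.
split; first exact: wishart_not_hyperplane.
by rewrite laplace_domain_wishart; exists one; exact: posdef_one.
Qed.

Lemma wishart_self_dual : dual_measure mu mu.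
Proof.
have mean_posdef s : posdef_cone s -> posdef_cone (mean_map mu s).
  move=> ps; rewrite mean_map_wishart // => u u0.
  rewrite -/(bform _ _ _) -/(qform _ _) symZ qform_mxZ mulr_gt0 // sym_ofK.
    by apply: pdmxV => //; exact: trmx_sym.
  by rewrite trmx_inv_sym // trmx_sym.
split; [exact: wishart_measureM|exact: wishart_measureM| |].
  rewrite /mean_domain laplace_domain_wishart => _ [s ps <-].
  exact: mean_posdef.
rewrite laplace_domain_wishart => s ps.
rewrite mean_map_wishart; last exact: mean_posdef.
rewrite mean_map_wishart //; apply: sym_inj.
have us := pdmx_unit ps; have ss := trmx_sym s.
rewrite symZ symZ (sym_ofK (trmx_inv_sym ss)) invmxZ; last first.
  by rewrite unitmxZ ?unitfE ?gt_eqF // unitmx_inv.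
rewrite invmxK sym_ofK; last by rewrite linearZ /= ss.
by rewrite scalerA mulfV ?scale1r ?gt_eqF.
Qed.

End wishart.

Lemma gindikin_gt0 (R : realType) n (p : R) :
  (0 < n)%N -> gindikin_set n p -> 0 < p.
Proof.
move=> n0 [[k /andP[k0 _] ->]|/= np]; first by rewrite divr_gt0 // ltr0n.
by apply: le_lt_trans np; rewrite divr_ge0 // subr_ge0 ler1n.
Qed.

Theorem mainTheorem8 (R : realType) (n : nat) (hn : (0 < n)%N) (p : R)
    (hp : gindikin_set n p)
    (mu : {measure set (borel (symmx R n)) -> \bar R})
    (hmu : wishart_measure p mu) :
  dual_measure mu mu.
Proof. exact: wishart_self_dual hn (gindikin_gt0 hn hp) hmu. Qed.
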